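(* Let $G=(V,E)$ be an irreducible graph with $n$ vertices and $\mathrm{diam}(G)=2$. If $G$ has at least one articulation neighborhood, then it can be decided in time polynomial in $n$ whether $G$ admits a proper $3$-coloring (and, if so, such a coloring can be computed in polynomial time).
   Context: Graphs are finite, simple and undirected. For a vertex $u$, $N(u)$ is its set of neighbors and $N[u]=N(u)\cup\{u\}$. For a vertex $v$ of $G$, the closed neighborhood $N[v]$ is an articulation neighborhood of $G$ if the graph $G-N[v]$ (obtained by deleting the vertices of $N[v]$) is disconnected. The diamond is the graph on $4$ vertices with $5$ edges ($K_4$ minus one edge). A graph $G$ is called irreducible if it contains no $K_4$ as an induced subgraph, contains no induced diamond, and has no two distinct vertices $u,v$ with $N(u)\subseteq N(v)$. *)

(* Defs.v *)
From mathcomp Require Import all_boot.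

Set Implicit Arguments.
Unset Strict Implicit.
Unset Printing Implicit Defensive.

Record sgraph (T : finType) := SGraph {
  adj :> rel T;
  adj_sym : symmetric adj;
  adj_irr : irreflexive adj
}.

Section Graphs.
Variable T : finType.
Implicit Types (G : sgraph T) (u x y : T).

Definition nbr G u : {set T} := [set w | G u w].
Definition cnbr G u : {set T} := u |: nbr G u.

(* The graph with no vertex counts as connected. *)
Definition connected G : bool := [forall x, forall y, connect G x y].

Definition walk G (k : nat) x y : bool :=
  [exists p : k.-tuple T, path G x p && (last x p == y)].

(* Two vertices of the same component are at distance less than #|T|; the
   value is #|T| for vertices of different components. *)
Definition dist G x y : nat := find (fun k => walk G k x y) (iota 0 #|T|).

(* A disconnected graph has infinite diameter, that is, no diameter d. *)
Definition has_diam G (d : nat) : Prop :=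
  connected G /\ \max_(x : T) \max_(y : T) dist G x y = d.

Section Induced.
Variables (G : sgraph T) (S : {set T}).
Let V := {x : T | x \in S}.
Definition induced_rel : rel V := fun a b => G (val a) (val b).
Fact induced_sym : symmetric induced_rel.
Proof. by move=> a b; apply: adj_sym. Qed.
Fact induced_irr : irreflexive induced_rel.
Proof. by move=> a; apply: adj_irr. Qed.
Definition induced : sgraph V := SGraph induced_sym induced_irr.
End Induced.

Definition proper_coloring G (k : nat) (f : T -> 'I_k) : Prop :=
  forall x y, G x y -> f x != f y.

Definition colorable G (k : nat) : Prop :=
  exists f : T -> 'I_k, proper_coloring G f.

End Graphs.

Definition articulation_nbhd (T : finType) (G : sgraph T) (v : T) : Prop :=
  ~~ connected (induced G (~: cnbr G v)).

Definition has_induced (S T : finType) (H : sgraph S) (G : sgraph T) : Prop :=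
  exists f : S -> T, injective f /\ forall x y, G (f x) (f y) = H x y.

Definition K4_rel : rel 'I_4 := fun x y => x != y.
Fact K4_sym : symmetric K4_rel.
Proof. by move=> x y; rewrite /K4_rel eq_sym. Qed.
Fact K4_irr : irreflexive K4_rel.
Proof. by move=> x; rewrite /K4_rel eqxx. Qed.
Definition K4 : sgraph 'I_4 := SGraph K4_sym K4_irr.

(* The missing edge joins the vertices 0 and 1. *)
Definition diamond_rel : rel 'I_4 :=
  fun x y => (x != y) && ~~ ((x < 2) && (y < 2)).
Fact diamond_sym : symmetric diamond_rel.
Proof. by move=> x y; rewrite /diamond_rel eq_sym [(y < 2) && _]andbC. Qed.
Fact diamond_irr : irreflexive diamond_rel.
Proof. by move=> x; rewrite /diamond_rel eqxx. Qed.
Definition diamond : sgraph 'I_4 := SGraph diamond_sym diamond_irr.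

Definition irreducible (T : finType) (G : sgraph T) : Prop :=
  [/\ ~ has_induced K4 G,
      ~ has_induced diamond G
    & forall u v : T, u != v -> ~~ (nbr G u \subset nbr G v)].

(* Programs of a random access machine over nat, in structured form: a memory
   of scalar registers, and of arrays with unbounded indices, both named by
   natural numbers.  Every instruction, and every node of an expression, costs
   one unit of time.  There is addition and truncated subtraction but no
   multiplication, so that a value gains at most one bit per time unit, and
   polynomial time is the same as on Turing machines. *)

Inductive expr :=
| Const of nat
| Reg of nat
| Get of nat & expr          (* Get a i reads cell i of array a *)
| Add of expr & expr
| Sub of expr & expr.

Inductive com :=
| Skip
| Assign of nat & expr        (* Assign x e writes e to register x *)
| Store of nat & expr & expr  (* Store a i e writes e to cell i of array a *)
| Seq of com & com
| If of expr & com & com      (* in tests, every nonzero value is true *)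
| While of expr & com.

Record state := State { reg : nat -> nat; arr : nat -> nat -> nat }.

Definition upd (A : Type) (f : nat -> A) (x : nat) (v : A) : nat -> A :=
  fun y => if y == x then v else f y.

Definition set_reg (s : state) (x v : nat) : state :=
  State (upd (reg s) x v) (arr s).

Definition set_arr (s : state) (a i v : nat) : state :=
  State (reg s) (upd (arr s) a (upd (arr s a) i v)).

Fixpoint eval (s : state) (e : expr) : nat :=
  match e with
  | Const m => m
  | Reg x => reg s x
  | Get a i => arr s a (eval s i)
  | Add e1 e2 => eval s e1 + eval s e2
  | Sub e1 e2 => eval s e1 - eval s e2
  end.

Fixpoint cost (e : expr) : nat :=
  match e with
  | Const _ | Reg _ => 1
  | Get _ i => (cost i).+1
  | Add e1 e2 | Sub e1 e2 => (cost e1 + cost e2).+1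
  end.

(* exec c s t s' : started in s, the program c halts in s' after time t. *)
Inductive exec : com -> state -> nat -> state -> Prop :=
| ExecSkip s : exec Skip s 1 s
| ExecAssign x e s :
    exec (Assign x e) s (cost e).+1 (set_reg s x (eval s e))
| ExecStore a i e s :
    exec (Store a i e) s (cost i + cost e).+1
         (set_arr s a (eval s i) (eval s e))
| ExecSeq c1 c2 s1 t1 s2 t2 s3 :
    exec c1 s1 t1 s2 -> exec c2 s2 t2 s3 -> exec (Seq c1 c2) s1 (t1 + t2) s3
| ExecIf e c1 c2 s t s' :
    exec (if eval s e != 0 then c1 else c2) s t s' ->
    exec (If e c1 c2) s (cost e + t).+1 s'
| ExecWhileFalse e c s :
    eval s e = 0 -> exec (While e c) s (cost e).+1 s
| ExecWhileTrue e c s1 t1 s2 t2 s3 :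
    eval s1 e != 0 -> exec c s1 t1 s2 -> exec (While e c) s2 t2 s3 ->
    exec (While e c) s1 (cost e + t1 + t2).+1 s3.

Lemma exec_det c s t1 s1 t2 s2 :
  exec c s t1 s1 -> exec c s t2 s2 -> t1 = t2 /\ s1 = s2.
Proof.
move=> E; elim: E t2 s2 => {c s t1 s1}.
- by move=> s t2 s2 E; inversion E.
- by move=> x e s t2 s2 E; inversion E.
- by move=> a i e s t2 s2 E; inversion E.
- move=> c1 c2 s1 t1 s2 t2 s3 _ IH1 _ IH2 t s E.
  inversion_clear E as [| | |? ? ? ? ? ? ? E1 E2| | |].
  by case: (IH1 _ _ E1) E2 => <- <- /IH2[<- <-].
- move=> e c1 c2 s t s' _ IH t2 s2 E.
  inversion_clear E as [| | | |? ? ? ? ? ? E1| |].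
  by have [<- <-] := IH _ _ E1.
- move=> e c s e0 t2 s2 E; inversion E; subst=> //.
  by match goal with A : is_true (_ != 0) |- _ => rewrite e0 in A end.
- move=> e c s1 t1 s2 t2 s3 e0 _ IH1 _ IH2 t s E; inversion E; subst.
    by match goal with A : _ = 0 |- _ => rewrite A in e0 end.
  match goal with A : exec c _ _ _, B : exec (While e c) _ _ _ |- _ =>
    by case: (IH1 _ _ A) B => <- <- /IH2[<- <-]
  end.
Qed.

(* The input: n in register 0, the adjacency matrix in array 0, row by row,
   and 0 in all the rest of the memory. *)
Definition init (n : nat) (G : sgraph 'I_n) : state :=
  State (upd (fun=> 0) 0 n)
        (upd (fun=> fun=> 0) 0
           (fun p => [exists i : 'I_n, exists j : 'I_n,
                        (p == i * n + j) && G i j] : nat)).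

(* Graphs on n vertices are given with vertex set {0, ..., n-1}.  This is a
   promise problem: nothing is required outside the class K. *)
Definition poly_time_on (K : forall n, sgraph 'I_n -> Prop)
    (post : forall n, sgraph 'I_n -> state -> Prop) : Prop :=
  exists (c : com) (a k : nat), forall (n : nat) (G : sgraph 'I_n), K n G ->
  exists (t : nat) (s : state),
    [/\ exec c (init G) t s, t <= a * n ^ k + a & post n G s].

(* The answer is read in register 0: 1 for yes, 0 for no. *)
Definition poly_time_decidable_on (K P : forall n, sgraph 'I_n -> Prop) :=
  poly_time_on K (fun n G s =>
    (P n G -> reg s 0 = 1) /\ (~ P n G -> reg s 0 = 0)).

(* The color of vertex i is read in cell i of array 1. *)
Definition poly_time_coloring_on (K : forall n, sgraph 'I_n -> Prop)
    (k : nat) :=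
  poly_time_on (fun n G => K n G /\ colorable G k) (fun n G s =>
    exists f : 'I_n -> 'I_k,
      proper_coloring G f /\ forall i : 'I_n, arr s 1 i = f i).

(* Main.v *)
Require Import Defs.
From mathcomp Require Import all_boot.

Set Implicit Arguments.
Unset Strict Implicit.
Unset Printing Implicit Defensive.

(** Let N[v] be an articulation neighborhood, let f be a 3-coloring and let u, w
    be vertices in distinct components of G - N[v] whose colors differ from that
    of v.  Once v, u and w are colored, unit propagation leaves at most two
    colors for every vertex: a vertex x outside N[v] is separated from u, say,
    so x and u have a common neighbor in N(v), and only one color remains for
    it.  An algorithm thus tries all triples of vertices and all their colors;
    each time it completes the resulting lists of length two greedily, fixing
    the color of one vertex after the other and undoing the choice when
    propagation empties a list, and finally checks the coloring found. *)

(** * List coloring with three colors *)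

Lemma third_color (a b : 'I_3) : exists c : 'I_3, (c != a) && (c != b).
Proof.
suff /existsP : [exists c : 'I_3, (c != a) && (c != b)] by [].
rewrite -[[exists _, _]]negbK negb_exists; apply/negP => /forallP ab.
have: #|'I_3| <= #|[set a; b]|.
  by apply/subset_leq_card/subsetP => c _; move: (ab c); rewrite !inE negb_and !negbK.
by rewrite card_ord cards2; case: (a != b).
Qed.

Lemma no_fourth_color (a b c d : 'I_3) :
  a != b -> c != a -> c != b -> d != a -> d != b -> d = c.
Proof.
by move: a b c d; do 4![case=> [[|[|[|?]]] ?] //]; move=> *; apply: val_inj.
Qed.

Section ListColoring.
Variables (T : finType) (G : sgraph T).
Implicit Types (L P Q : {set T * 'I_3}) (f : T -> 'I_3).

(** The stable states of unit propagation: a color [c] may stay at [y] only while each neighbor of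
    [y] keeps another color. An empty list thus empties the lists of its neighbors. *)
Definition arc_consistent L : Prop :=
  forall x y c, G x y -> (y, c) \in L -> exists2 d, d != c & (x, d) \in L.

Definition colors_from L f : Prop :=
  proper_coloring G f /\ forall x, (x, f x) \in L.

(** Arc-consistent sets are closed under union, so [L] contains a greatest one, and the order of
    removals does not matter. *)
Definition propagation L P : Prop :=
  [/\ P \subset L, arc_consistent P
    & forall Q, arc_consistent Q -> Q \subset L -> Q \subset P].

Definition assigned L f x : Prop := forall d, (x, d) \in L -> d = f x.

Definition short L : Prop := forall x, exists c, (x, c) \notin L.

Lemma short_sub L P : P \subset L -> short L -> short P.
Proof.
by move=> /subsetP PL sL x; have [c xc] := sL x; exists c; apply: contra xc => /PL.
Qed.

Lemma colors_from_sub L P f : P \subset L -> colors_from P f -> colors_from L f.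
Proof. by move=> /subsetP PL [pf fP]; split=> // x; apply: PL. Qed.

(** The graph of [f], as a set of pairs, is itself arc consistent and hence lies in the greatest
    arc-consistent subset. *)
Lemma colors_from_propagation L P f :
  propagation L P -> colors_from L f -> colors_from P f.
Proof.
case=> PL _ maxP [pf fL]; split=> // x.
have /subsetP : [set p | p.2 == f p.1] \subset P.
  apply: maxP => [y z c Gyz|].
    by rewrite inE => /= /eqP->; exists (f y); rewrite ?inE //= pf.
  by apply/subsetP => -[y c]; rewrite inE => /= /eqP->.
by apply; rewrite inE.
Qed.

(* A vertex that loses its color under f keeps a single color, because lists
   had length two; propagation has removed that color from its neighbors. *)
Lemma colors_from_short L P f :
    short L -> P \subset L -> arc_consistent P ->
    (forall x, exists c, (x, c) \in P) ->
  colors_from L f -> exists g, colors_from P g.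
Proof.
move=> sL PL acP neP [pf fL].
(* The default [ord0] is never taken, since no list of [P] is empty. *)
pose g x := if (x, f x) \in P then f x else odflt ord0 [pick c | (x, c) \in P].
have gP x : (x, g x) \in P.
  rewrite /g; have [//|_] := boolP ((x, f x) \in P).
  by case: pickP => // no; have [c] := neP x; rewrite no.
have gsingle x d : (x, f x) \notin P -> (x, d) \in P -> d = g x.
  move=> fxP xd; have [m mL] := sL x.
  have mP e : (x, e) \in P -> e != m.
    by apply: contraTneq => ->; apply: contra mL; apply: (subsetP PL).
  have fP e : (x, e) \in P -> e != f x by apply: contraTneq => ->.
  by apply: (@no_fourth_color m (f x)); [apply: contraNneq mL => -> | | | |]; auto.
exists g; split=> // x y Gxy; apply/eqP => gxy.
have edge a b : G a b -> (a, f a) \notin P -> g a != g b.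
  move=> Gab fa; apply/eqP => gab.
  have [d dg ad] := acP _ _ _ Gab (gP b).
  by move: dg; rewrite (gsingle _ _ fa ad) gab eqxx.
have [fx|fx] := boolP ((x, f x) \in P); last first.
  by move: (edge _ _ Gxy fx); rewrite gxy eqxx.
have [fy|fy] := boolP ((y, f y) \in P); last first.
  by move: (edge y x); rewrite adj_sym Gxy gxy eqxx => /(_ isT fy).
by move: gxy (pf _ _ Gxy); rewrite /g fx fy => ->; rewrite eqxx.
Qed.

(** * Short lists from an articulation neighborhood in diameter two *)

Lemma diam2_common_nbr x y :
  has_diam G 2 -> x != y -> ~~ G x y -> exists2 z, G x z & G z y.
Proof.
case=> cG dG xy Gxy.
have d2 : dist G x y <= 2.
  by rewrite -dG; apply: leq_trans (leq_bigmax x); apply: leq_bigmax y.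
(* A path without repetition has fewer than [#|T|] edges, so [find] succeeds and [dist] is the
   length of an actual walk rather than its default value. *)
have walkP : has (fun k => walk G k x y) (iota 0 #|T|).
  have /connectP[p pth] := forallP (forallP cG x) y.
  case/shortenP: pth => q pth uq _ ->.
  apply/hasP; exists (size q).
    by rewrite mem_iota -[_.+1]/(size (x :: q)) -(card_uniqP uq) max_card.
  by apply/existsP; exists (in_tuple q); rewrite pth eqxx.
have dlt : dist G x y < #|T| by rewrite -[X in _ < X](size_iota 0) -has_find.
move: (nth_find 0 walkP); rewrite -/(dist G x y) nth_iota // add0n.
move: d2 => /[swap] /existsP[[s /= /eqP <-]] /andP[].
case: s => [|z [|z' [|//]]] /=; rewrite ?andbT.
- by move=> _ xy'; rewrite xy' in xy.
- by move=> Gxz /eqP zy; rewrite -zy Gxz in Gxy.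
- by case/andP=> Gxz Gzz' /eqP <-; exists z.
Qed.

(* A vertex w alone in its component of G - N[v] would have N(w) included in
   N(v), so every component has an edge and thus a vertex not colored like v. *)
Lemma short_of_articulation v f :
    irreducible G -> has_diam G 2 -> articulation_nbhd G v ->
    proper_coloring G f ->
  exists u w, forall P, arc_consistent P ->
    assigned P f v -> assigned P f u -> assigned P f w -> short P.
Proof.
case=> _ _ irrG dG artG pf.
set S := ~: cnbr G v; set H := induced G S.
have inS x : (x \in S) = (x != v) && ~~ G v x by rewrite !inE negb_or.
have symH : connect_sym H by apply/sym_connect_sym/adj_sym.
have component (a : {x | x \in S}) :
    exists2 b : {x | x \in S}, connect H a b & f (val b) != f v.
  have [fa|fa] := eqVneq (f (val a)) (f v); last by exists a.
  have := valP a; rewrite inS => /andP[av Gva].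
  have /subsetPn[b] := irrG _ _ av.
  rewrite !inE => Gab Gvb.
  have bS : b \in S.
    by rewrite inS Gvb andbT; apply: contraNneq Gva => <-; rewrite adj_sym.
  exists (exist _ b bS); first exact: connect1.
  by rewrite /= -fa eq_sym pf.
have {artG} [a [b ab]] : exists a b, ~~ connect H a b.
  move: artG; rewrite /articulation_nbhd negb_forall => /existsP[a].
  by rewrite negb_forall => /existsP[b]; exists a, b.
have [u au fu] := component a; have [w bw fw] := component b.
exists (val u), (val w) => P acP vP uP wP x.
(* A common neighbor [z] of [x] and [y] inside [S] would connect them, so [z] is in N(v). Its
   neighbors [v] and [y] have distinct colors, which leaves [z] only the third color [c]; hence [x]
   loses [c]. *)
have separated (y : {x | x \in S}) (xS : x \in S) :
    f (val y) != f v -> assigned P f (val y) -> ~~ connect H y (exist _ x xS) ->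
  exists c, (x, c) \notin P.
  move=> fy yP yx.
  have [||z Gyz Gzx] := @diam2_common_nbr (val y) x dG.
  - by apply: contraNneq yx => yx; have -> : y = exist _ x xS by apply: val_inj.
  - by apply: contraNN yx => yx; apply: connect1.
  have zS : z \notin S.
    apply: contraNN yx => zS.
    by apply: (connect_trans (y := exist _ z zS)); apply: connect1.
  have Gvz : G v z.
    move: zS; rewrite inS negb_and !negbK => /orP[/eqP zv|//].
    by move: (valP y); rewrite inS -zv -[G z _]adj_sym Gyz andbF.
  have [c /andP[cv cy]] := third_color (f v) (f (val y)).
  exists c; apply/negP => xc; have [d dc zd] := acP _ _ _ Gzx xc.
  have [e ev vd] := acP _ _ _ Gvz zd; have [e' ey yd] := acP _ _ _ Gyz zd.
  move: dc; rewrite (@no_fourth_color (f v) (f (val y)) c d) ?eqxx //.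
  + by rewrite eq_sym.
  + by rewrite eq_sym -(vP _ vd).
  + by rewrite eq_sym -(yP _ yd).
(* A vertex outside N[v] misses the component of [u] or that of [w]. The vertex [v] keeps at most
   its own color, and its neighbors lose that color. *)
have [xS|] := boolP (x \in S).
  have [ux|ux] := boolP (connect H u (exist _ x xS)); last exact: separated ux.
  have [wx|wx] := boolP (connect H w (exist _ x xS)); last exact: separated wx.
  case/negP: ab; apply: connect_trans au _; apply: connect_trans ux _.
  by rewrite symH; apply: connect_trans bw _.
rewrite inS negb_and !negbK => /orP[/eqP->|Gvx].
  have [c /andP[cv _]] := third_color (f v) (f v).
  by exists c; apply: contra cv => /vP->.
exists (f v); apply/negP => xv; have [d dv vd] := acP _ _ _ Gvx xv.
by move: dv; rewrite (vP _ vd) eqxx.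
Qed.
End ListColoring.

(** * Programs with bounded loops *)

(* Programs whose only loops are LFor x p, which runs p for x = 0, ..., n - 1,
   with n in register 0.  They run in polynomial time as soon as they are well
   formed, so that only the function run that they compute has to be studied. *)
Inductive loop :=
| LSkip
| LSet of nat & expr
| LStore of nat & expr & expr
| LSeq of loop & loop
| LIf of expr & loop & loop
| LFor of nat & loop.

(** The loop test is the truncated difference n - x, nonzero exactly while x < n. *)
Fixpoint compile (p : loop) : com :=
  match p with
  | LSkip => Skip
  | LSet x e => Assign x e
  | LStore a i e => Store a i e
  | LSeq p q => Seq (compile p) (compile q)
  | LIf e p q => If e (compile p) (compile q)
  | LFor x p =>
      Seq (Assign x (Const 0))
          (While (Defs.Sub (Reg 0) (Reg x))
             (Seq (compile p) (Assign x (Add (Reg x) (Const 1)))))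
  end.

Definition incr (x : nat) (s : state) : state := set_reg s x (reg s x + 1).

Fixpoint run (p : loop) (s : state) : state :=
  match p with
  | LSkip => s
  | LSet x e => set_reg s x (eval s e)
  | LStore a i e => set_arr s a (eval s i) (eval s e)
  | LSeq p q => run q (run p s)
  | LIf e p q => if eval s e != 0 then run p s else run q s
  | LFor x p => iter (reg s 0) (fun s => incr x (run p s)) (set_reg s x 0)
  end.

Fixpoint wregs (p : loop) : seq nat :=
  match p with
  | LSkip | LStore _ _ _ => [::]
  | LSet x _ => [:: x]
  | LSeq p q | LIf _ p q => wregs p ++ wregs q
  | LFor x p => x :: wregs p
  end.

Fixpoint warrs (p : loop) : seq nat :=
  match p with
  | LSkip | LSet _ _ => [::]
  | LStore a _ _ => [:: a]
  | LSeq p q | LIf _ p q => warrs p ++ warrs q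
  | LFor _ p => warrs p
  end.

(** Register 0 always holds n and no body touches the counter of its loop, so each loop makes
    exactly n rounds. *)
Fixpoint wf (p : loop) : bool :=
  match p with
  | LSkip | LStore _ _ _ => true
  | LSet x _ => x != 0
  | LSeq p q | LIf _ p q => wf p && wf q
  | LFor x p => [&& x != 0, x \notin wregs p & wf p]
  end.

(** * Running time and frame of programs with bounded loops *)

Lemma wf_wregs p : wf p -> 0 \notin wregs p.
Proof.
elim: p => //= [x _|p IHp q IHq|_ p IHp q IHq|x p IHp].
- by rewrite inE eq_sym.
- by case/andP=> /IHp p0 /IHq q0; rewrite mem_cat negb_or p0.
- by case/andP=> /IHp p0 /IHq q0; rewrite mem_cat negb_or p0.
- by case/and3P=> x0 _ /IHp p0; rewrite inE negb_or eq_sym x0.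
Qed.

(** A round of a loop pays 4 for the test and 4 for the increment; the remaining 6 are 2 for the
    initialization and 4 for the last, failing test. *)
Fixpoint time (p : loop) (n : nat) : nat :=
  match p with
  | LSkip => 1
  | LSet _ e => (cost e).+1
  | LStore _ i e => (cost i + cost e).+1
  | LSeq p q => time p n + time q n
  | LIf e p q => (cost e + (time p n + time q n)).+1
  | LFor _ p => n * (time p n + 8) + 6
  end.

(** The base n + 1 is positive, so its powers grow with the exponent, and two bounds are added by
    adding coefficients and exponents. *)
Lemma time_poly p : exists a k, forall n, time p n <= a * n.+1 ^ k.
Proof.
have const m : exists a k, forall n, m <= a * n.+1 ^ k.
  by exists m, 0 => n; rewrite muln1.
have add (f g : nat -> nat) : (exists a k, forall n, f n <= a * n.+1 ^ k) ->
    (exists a k, forall n, g n <= a * n.+1 ^ k) ->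
  exists a k, forall n, f n + g n <= a * n.+1 ^ k.
  move=> [a [k fP]] [b [l gP]]; exists (a + b), (k + l) => n.
  rewrite mulnDl; apply: leq_add.
    by apply: leq_trans (fP n) _; rewrite leq_mul2l leq_pexp2l ?leq_addr ?orbT.
  by apply: leq_trans (gP n) _; rewrite leq_mul2l leq_pexp2l ?leq_addl ?orbT.
elim: p => /= [|_ e|_ i e|p IHp q IHq|e p IHp q IHq|_ p IHp]; try exact: const.
- exact: add.
- exact: (add _ _ (const (cost e).+1) (add _ _ IHp IHq)).
- apply: (add _ _ _ (const 6)); have [a [k fP]] := add _ _ IHp (const 8).
  exists a, k.+1 => n; rewrite expnS mulnCA.
  by apply: leq_mul; rewrite ?leqnSn.
Qed.

Definition same (rs ars : seq nat) (s s' : state) : Prop :=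
  (forall x, x \notin rs -> reg s' x = reg s x)
  /\ (forall a, a \notin ars -> arr s' a = arr s a).

Definition frame p := same (wregs p) (warrs p).

Lemma same_refl rs ars s : same rs ars s s.
Proof. by []. Qed.

Lemma same_trans rs ars s1 s2 s3 :
  same rs ars s1 s2 -> same rs ars s2 s3 -> same rs ars s1 s3.
Proof.
move=> [r12 a12] [r23 a23]; split=> [x xrs|a aas]; first by rewrite r23 // r12.
by rewrite a23 // a12.
Qed.

Lemma same_sub rs ars rs' as' s s' :
  {subset rs <= rs'} -> {subset ars <= as'} -> same rs ars s s' -> same rs' as' s s'.
Proof.
move=> rr aa [rE aE]; split=> [x xr|a ar]; first by rewrite rE ?(contra (rr x)).
by rewrite aE ?(contra (aa a)).
Qed.

Lemma same_set_reg rs ars s x v : x \in rs -> same rs ars s (set_reg s x v).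
Proof.
by move=> xr; split=> // y yr; rewrite /= /upd; case: eqP yr => // ->; rewrite xr.
Qed.

(** What a program may change is read off its text, so that later preservation claims become
    membership tests that compute. *)
Lemma run_frame p s : frame p s (run p s).
Proof.
rewrite /frame; elim: p s => [|x e|a i e|p IHp q IHq|e p IHp q IHq|x p IHp] s //=.
- by apply: same_set_reg; rewrite inE.
- by split=> // b; rewrite inE /= /upd => /negPf->.
- by apply: same_trans (same_sub _ _ (IHp s)) (same_sub _ _ (IHq _)) => y;
    rewrite mem_cat => ->; rewrite ?orbT.
- by case: ifP => _; [apply: same_sub (IHp s) | apply: same_sub (IHq s)] => y;
    rewrite mem_cat => ->; rewrite ?orbT.
- elim: (reg s 0) => [|m IHm] /=; first by apply: same_set_reg; rewrite inE eqxx.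
  apply: same_trans IHm _.
  apply: same_trans (same_set_reg _ _ _ (mem_head _ _)).
  by apply: same_sub (IHp _) => // y; rewrite inE orbC => ->.
Qed.

Lemma run_reg p s x : x \notin wregs p -> reg (run p s) x = reg s x.
Proof. by case: (run_frame p s) => + _; apply. Qed.

Lemma run_arr p s a : a \notin warrs p -> arr (run p s) a = arr s a.
Proof. by case: (run_frame p s) => _; apply. Qed.

Lemma exec_compile p s : wf p ->
  exists2 t, t <= time p (reg s 0) & exec (compile p) s t (run p s).
Proof.
elim: p s => [|x e|a i e|p IHp q IHq|e p IHp q IHq|x p IHp] s //=.
- by exists 1; last constructor.
- by exists (cost e).+1; last constructor.
- by exists (cost i + cost e).+1; last constructor.
- case/andP=> wp wq; have [t1 tp1 e1] := IHp s wp; have [t2 tp2 e2] := IHq (run p s) wq.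
  exists (t1 + t2); last exact: ExecSeq e1 e2.
  by rewrite leq_add // (leq_trans tp2) // run_reg // wf_wregs.
- case/andP=> wp wq; have [t1 tp1 e1] := IHp s wp; have [t2 tp2 e2] := IHq s wq.
  case: ifP => e0.
    exists (cost e + t1).+1; last by apply: ExecIf; rewrite e0.
    by rewrite ltnS leq_add2l (leq_trans tp1) ?leq_addr.
  exists (cost e + t2).+1; last by apply: ExecIf; rewrite e0.
  by rewrite ltnS leq_add2l (leq_trans tp2) ?leq_addl.
- case/and3P=> x0 xp wp; set n := reg s 0.
  pose step s := incr x (run p s); set s0 := set_reg s x 0.
  pose W := While (Defs.Sub (Reg 0) (Reg x))
    (Seq (compile p) (Assign x (Add (Reg x) (Const 1)))).
  (* Here [m] is the number of rounds still to run, and 4 pays for the failing test. *)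
  suff loopP m s1 : reg s1 0 = n -> reg s1 x + m = n ->
      exists2 t, t <= m * (time p n + 8) + 4 & exec W s1 t (iter m step s1).
    have [||t tn et] := loopP n s0; first by rewrite /= /upd eq_sym (negPf x0).
      by rewrite /= /upd eqxx.
    exists (2 + t); first by rewrite -[6]/(4 + 2) addnA addnC leq_add2r.
    by apply: ExecSeq et; apply: (ExecAssign x (Const 0)).
  elim: m s1 => [|m IHm] s1 s10 s1x.
    exists 4 => //; apply: ExecWhileFalse => /=.
    by rewrite s10 -s1x addn0 subnn.
  have [t1 t1n e1] := IHp s1 wp.
  have [||t2 t2n e2] := IHm (step s1).
  - by rewrite /= /upd eq_sym (negPf x0) run_reg ?wf_wregs.
  - by rewrite /= /upd eqxx run_reg // -addnA.
  exists (3 + (t1 + 4) + t2).+1; last first.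
    rewrite iterSr; apply: (ExecWhileTrue _ _ e2); first by rewrite /= s10 -s1x addKn.
    exact: ExecSeq e1 (ExecAssign x (Add (Reg x) (Const 1)) _).
  have -> : (3 + (t1 + 4) + t2).+1 = t1 + 8 + t2.
    by rewrite addnCA addnS -addSn -addnS.
  rewrite s10 in t1n; rewrite mulSn -[X in _ <= X]addnA.
  by apply: leq_add t2n; rewrite leq_add2r.
Qed.

(** The invariant rule; through [frame] each round knows that whatever the loop never writes is as
    on entry. *)
Lemma for_ind n x p (I : nat -> state -> Prop) s :
    wf (LFor x p) -> reg s 0 = n -> I 0 (set_reg s x 0) ->
    (forall (i : 'I_n) s', frame (LFor x p) s s' -> reg s' x = i -> I i s' ->
       I i.+1 (set_reg (run p s') x i.+1)) ->
  I n (run (LFor x p) s).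
Proof.
move=> /= /and3P[x0 xp wp] sn I0 IS; rewrite sn.
pose step s := incr x (run p s); set s0 := set_reg s x 0.
suff loopP m : m <= n -> [/\ frame (LFor x p) s (iter m step s0),
    reg (iter m step s0) x = m & I m (iter m step s0)] by case: (loopP n).
elim: m => [|m IHm] mn.
  by split=> //; [apply/same_set_reg/mem_head | rewrite /= /upd eqxx].
have [fr rx Im] := IHm (ltnW mn); rewrite iterS; set s1 := iter m step s0 in fr rx Im *.
have stepE : step s1 = set_reg (run p s1) x m.+1.
  by rewrite /step /incr run_reg // rx addn1.
split; rewrite stepE; last exact: (IS (Ordinal mn)).
  apply: same_trans fr _; apply: same_trans (same_set_reg _ _ _ (mem_head _ _)).
  by apply: same_sub (run_frame p _) => // y; rewrite inE orbC => ->.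
by rewrite /= /upd eqxx.
Qed.

(** * Loops whose rounds respect a preorder on states *)

Section Preorder.
Variable R : state -> state -> Prop.
Hypothesis R_refl : forall s, R s s.
Hypothesis R_trans : forall s1 s2 s3, R s1 s2 -> R s2 s3 -> R s1 s3.

(** Round [i] establishes [P i], and the later rounds, which move upwards in [R], preserve it. *)
Lemma for_all n x p (P : 'I_n -> state -> Prop) s :
    wf (LFor x p) -> reg s 0 = n ->
    (forall s v, R s (set_reg s x v)) ->
    (forall i s s', R s s' -> P i s -> P i s') ->
    (forall (i : 'I_n) s', frame (LFor x p) s s' -> R s s' -> reg s' x = i ->
       R s' (run p s') /\ P i (run p s')) ->
  R s (run (LFor x p) s) /\ forall i, P i (run (LFor x p) s).
Proof.
move=> wp sn Rset Pmono body.
pose I i s' := R s s' /\ forall j : 'I_n, j < i -> P j s'.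
suff [Rs Pn] : I n (run (LFor x p) s) by split=> // i; apply: Pn.
apply: for_ind => // i s' fr xi [Rs Pi].
have [Rs' Pi'] := body i s' fr Rs xi.
split=> [|j]; first exact: R_trans Rs (R_trans Rs' (Rset _ _)).
rewrite ltnS leq_eqVlt => /orP[/eqP/val_inj->|ji]; first exact: Pmono (Rset _ _) _.
by apply: (Pmono _ s' _ (R_trans Rs' (Rset _ _))); apply: Pi.
Qed.

(** The loop over colors is unrolled, because a color selects an array and array names are constants
    of a program. *)
Definition Each (p : nat -> loop) : loop := LSeq (p 0) (LSeq (p 1) (p 2)).

Lemma each_all p (P : 'I_3 -> state -> Prop) s :
    (forall c s s', R s s' -> P c s -> P c s') ->
    (forall (c : 'I_3) s', frame (Each p) s s' -> R s s' ->
       R s' (run (p c) s') /\ P c (run (p c) s')) ->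
  R s (run (Each p) s) /\ forall c, P c (run (Each p) s).
Proof.
move=> Pmono body.
set s1 := run (p 0) s; set s2 := run (p 1) s1; rewrite -[run _ s]/(run (p 2) s2).
have [R1 P0] := body (@Ordinal 3 0 isT) s (same_refl _ _ s) (R_refl s).
have f1 : frame (Each p) s s1.
  by apply: same_sub (run_frame (p 0) s) => y; rewrite /= !mem_cat => ->.
have [R2 P1] := body (@Ordinal 3 1 isT) s1 f1 R1.
have f2 : frame (Each p) s s2.
  apply: same_trans f1 _.
  by apply: same_sub (run_frame (p 1) s1) => y; rewrite /= !mem_cat => ->; rewrite orbT.
have [R3 P2] := body (@Ordinal 3 2 isT) s2 f2 (R_trans R1 R2).
split=> [|c]; first exact: R_trans R1 (R_trans R2 R3).
case: c => [[|[|[|//]]] c3].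
- rewrite (_ : Ordinal c3 = @Ordinal 3 0 isT); last exact: val_inj.
  by apply: Pmono R3 (Pmono _ _ _ R2 P0).
- rewrite (_ : Ordinal c3 = @Ordinal 3 1 isT); last exact: val_inj.
  exact: Pmono R3 P1.
- by rewrite (_ : Ordinal c3 = @Ordinal 3 2 isT); last apply: val_inj.
Qed.

End Preorder.

Lemma poly_time_on_loop (K : forall n, sgraph 'I_n -> Prop) post p r :
    wf p ->
    (forall n (G : sgraph 'I_n), K n G ->
       let s := run p (init G) in post n G (set_reg s 0 (reg s r))) ->
  poly_time_on K post.
Proof.
move=> wp postP; have [a [k tP]] := time_poly p.
(* For n > 0, n + 1 is at most 2n, which gives the factor [2 ^ k]; for n = 0 the additive constant
   suffices. The final move to register 0 costs 2. *)
exists (Seq (compile p) (Assign 0 (Reg r))), (a * 2 ^ k + 2), k => n G KG.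
have [t tn et] := exec_compile (init G) wp.
exists (t + 2), (set_reg (run p (init G)) 0 (reg (run p (init G)) r)).
split; [exact: ExecSeq et (ExecAssign _ (Reg _) _) | | exact: postP].
rewrite addnA leq_add2r (leq_trans tn) // (leq_trans (tP _)) //.
rewrite /= /upd /=; case: n {G KG t tn et} => [|n].
  by rewrite exp1n muln1 (leq_trans _ (leq_addl _ _)) // leq_pmulr ?expn_gt0.
rewrite (leq_trans _ (leq_addr _ _)) // mulnDl (leq_trans _ (leq_addr _ _)) //.
rewrite -mulnA -expnMn leq_mul2l; apply/orP; right.
by elim: (k) => // m IHm; rewrite !expnS leq_mul // mul2n -addnn addSn ltnS leq_addl.
Qed.

(** * The algorithm *)

Lemma run_seq p q s : run (LSeq p q) s = run q (run p s).
Proof. by []. Qed.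

(** A disjunction of three tests: a sum of naturals is nonzero exactly if some summand is. *)
Definition sum3 (e : nat -> expr) : expr := Add (e 0) (Add (e 1) (e 2)).

Lemma eval_sum3 s e :
  (eval s (sum3 e) != 0) = [exists c : 'I_3, eval s (e c) != 0].
Proof.
apply/idP/existsP => /=; rewrite !addn_eq0 !negb_and.
  by case/or3P=> ec; [exists (@Ordinal 3 0 isT) | exists (@Ordinal 3 1 isT)
                     | exists (@Ordinal 3 2 isT)].
by case=> -[[|[|[|//]]] c3] /= ->; rewrite ?orbT.
Qed.

(* Array 0 holds the adjacency matrix, array 1 the output, array 2 the offsets
   of the rows of the matrix, arrays 3 + c the vertices with color c in their
   list, arrays 6 + c a backup of these.  Register 1 holds the answer. *)

(** Multiplication being absent, the offset i * n of row i is built by repeated addition. *)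
Definition row_offsets : loop :=
  LFor 8 (LStore 2 (Add (Reg 8) (Const 1)) (Add (Get 2 (Reg 8)) (Reg 0))).

Definition edge (x y : nat) : expr := Get 0 (Add (Get 2 (Reg x)) (Reg y)).

Definition table (b x : nat) (e : nat -> expr) : loop :=
  LFor x (Each (fun c => LStore (b + c) (Reg x) (e c))).

(** The color [c] is kept only if still present, so two contradictory guesses for one vertex leave
    it an empty list. *)
Definition assign (x c : nat) : loop :=
  Each (fun d => LStore (3 + d) (Reg x)
                   (if d == c then Get (3 + d) (Reg x) else Const 0)).

Definition revise (x y c : nat) : loop :=
  LIf (sum3 (fun d => if d == c then Const 0 else Get (3 + d) (Reg x)))
      LSkip (LStore (3 + c) (Reg y) (Const 0)).

Definition revise_all : loop :=
  LFor 8 (LFor 9 (LIf (edge 8 9) (Each (revise 8 9)) LSkip)).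

(** Each sweep before stability removes one of at most 3n pairs, so 3n sweeps suffice. *)
Definition propagate : loop := LFor 7 (Each (fun=> revise_all)).

Definition check_nonempty : loop :=
  LFor 8 (LIf (sum3 (fun d => Get (3 + d) (Reg 8))) LSkip (LSet 6 (Const 0))).

Definition check_disjoint : loop :=
  LFor 8 (LFor 9 (LIf (edge 8 9)
    (Each (fun c => LIf (Get (3 + c) (Reg 8))
                        (LIf (Get (3 + c) (Reg 9)) (LSet 6 (Const 0)) LSkip)
                        LSkip))
    LSkip)).

Definition trial (x c : nat) : loop :=
  LSeq (table 6 8 (fun d => Get (3 + d) (Reg 8)))
  (LSeq (assign x c)
  (LSeq propagate
  (LSeq (LSet 6 (Const 1))
  (LSeq check_nonempty
  (LIf (Reg 6) LSkip (table 3 8 (fun d => Get (6 + d) (Reg 8)))))))).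

(** Once a color of the vertex is accepted, a later trial of another color empties its list and is
    undone. *)
Definition greedy : loop := LFor 5 (Each (trial 5)).

Definition write_colors : loop :=
  LFor 8 (Each (fun c => LIf (Get (3 + c) (Reg 8))
                             (LStore 1 (Reg 8) (Const c)) LSkip)).

Definition output : loop := LSeq (LSet 1 (Const 1)) write_colors.

Definition finish : loop :=
  LSeq (LSet 6 (Const 1))
  (LSeq check_nonempty
  (LSeq check_disjoint
  (LIf (Reg 6) output LSkip))).

Definition guess (a b c : nat) : loop :=
  LSeq (table 3 8 (fun=> Const 1))
  (LSeq (assign 2 a)
  (LSeq (assign 3 b)
  (LSeq (assign 4 c)
  (LSeq propagate
  (LSeq greedy finish))))).

Definition search : loop :=
  LFor 2 (LFor 3 (LFor 4 (Each (fun a => Each (fun b => Each (guess a b)))))).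

Definition solve : loop := LSeq row_offsets search.

(** * Effect of the programs on the lists *)

Section Algorithm.
Variables (n : nat) (G : sgraph 'I_n).
Implicit Types (s : state) (f : 'I_n -> 'I_3) (L P Q : {set 'I_n * 'I_3}).

Definition cells (b : nat) s : {set 'I_n * 'I_3} :=
  [set p : 'I_n * 'I_3 | arr s (b + p.2) p.1 != 0].

Notation lists := (cells 3).

Lemma in_cells b s (x : 'I_n) (c : 'I_3) :
  ((x, c) \in cells b s) = (arr s (b + c) x != 0).
Proof. by rewrite inE. Qed.

Definition env s : Prop :=
  reg s 0 = n /\ forall i j : 'I_n, (arr s 0 (arr s 2 i + j) != 0) = G i j.

Lemma env_same rs ars s s' : same rs ars s s' ->
  0 \notin rs -> (0 \notin ars) && (2 \notin ars) -> env s -> env s'.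
Proof.
by move=> [rE aE] r0 /andP[a0 a2] [s0 sG]; split=> [|i j]; rewrite ?rE // !aE.
Qed.

Lemma env_run p s : wf p -> (0 \notin warrs p) && (2 \notin warrs p) ->
  env s -> env (run p s).
Proof. by move=> /wf_wregs; apply/env_same/run_frame. Qed.

Lemma cells_same b rs ars s s' : same rs ars s s' ->
  [&& b \notin ars, b + 1 \notin ars & b + 2 \notin ars] -> cells b s' = cells b s.
Proof.
move=> [_ aE] /and3P[a0 a1 a2]; apply/setP => -[x c]; rewrite !in_cells.
by case: c => [[|[|[|//]]] c3]; rewrite /= aE // addn0.
Qed.

Lemma cells_run b p s :
  [&& b \notin warrs p, b + 1 \notin warrs p & b + 2 \notin warrs p] ->
  cells b (run p s) = cells b s.
Proof. exact/cells_same/run_frame. Qed.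

Lemma edgeE s r q (x y : 'I_n) : env s -> reg s r = x -> reg s q = y ->
  (eval s (edge r q) != 0) = G x y.
Proof. by case=> _ sG /= -> ->. Qed.

Lemma run_table b x e s (Q : {set 'I_n * 'I_3}) :
    x != 0 -> reg s 0 = n ->
    (forall s' (y : 'I_n) (c : 'I_3), frame (table b x e) s s' ->
       reg s' x = y -> (eval s' (e c) != 0) = ((y, c) \in Q)) ->
  cells b (run (table b x e) s) = Q.
Proof.
move=> x0 sn eQ.
pose right y c s := ((y, c) \in cells b s) = ((y, c) \in Q).
(* A round stores only right values, so a right cell is never spoiled. *)
pose R s s' := forall y c, right y c s -> right y c s'.
have R_refl s1 : R s1 s1 by [].
have R_trans s1 s2 s3 : R s1 s2 -> R s2 s3 -> R s1 s3.
  by move=> R12 R23 y c /R12/R23.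
have right_set_reg s1 v : R s1 (set_reg s1 x v) by [].
have wfT : wf (table b x e) by rewrite /= x0.
have [|||_ tP] := for_all R_trans (P := fun y s => forall c, right y c s) wfT sn.
- exact: right_set_reg.
- by move=> y s1 s2 R12 rs1 c; apply: R12.
- move=> y s1 fr1 _ s1x.
  apply: each_all => // [c s2 s3 R23|c s2 fr2 _]; first exact: R23.
  have s2x : reg s2 x = y by case: fr2 => + _ => ->.
  have fr : frame (table b x e) s s2.
    by apply: same_trans fr1 _; apply: same_sub fr2 => // z; rewrite inE orbC => ->.
  have eyc := eQ s2 y c fr s2x.
  have rstore z d : ((z, d) \in cells b (run (LStore (b + c) (Reg x) (e c)) s2))
      = if (z == y) && (d == c) then (y, c) \in Q else (z, d) \in cells b s2.
    rewrite -eyc !in_cells -[z == y](inj_eq val_inj) -[d == c](inj_eq val_inj) /=.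
    rewrite /upd s2x eqn_add2l.
    by case: (d =P c :> nat) => [->|_]; case: (z =P y :> nat) => [_|_].
  split; last by rewrite /right rstore !eqxx.
  move=> z d; rewrite /right rstore.
  by case: andP => // -[/eqP-> /eqP->].
- by apply/setP => -[y c]; apply: tP.
Qed.

Lemma run_assign x (c : 'I_3) s (y : 'I_n) : reg s x = y ->
  lists (run (assign x c) s) = [set p in lists s | (p.1 == y) ==> (p.2 == c)].
Proof.
move=> xy; apply/setP => -[z d]; rewrite inE !in_cells /=.
rewrite /upd xy -!(inj_eq val_inj) /=.
case: c => [[|[|[|?]]] c3]; case: d => [[|[|[|?]]] d3]; try (by []);
  by rewrite /= ?xy; case: (z =P y :> nat) => [->|_]; rewrite /= ?andbT ?andbF.
Qed.

(** All removals are forced: the lists of both states have the same arc-consistent subsets. *)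
Definition prunes s s' : Prop :=
  lists s' \subset lists s
  /\ forall Q, arc_consistent G Q -> Q \subset lists s -> Q \subset lists s'.

Lemma prunes_refl s : prunes s s. Proof. by []. Qed.

Lemma prunes_trans s1 s2 s3 : prunes s1 s2 -> prunes s2 s3 -> prunes s1 s3.
Proof.
move=> [L21 Q12] [L32 Q23]; split; first exact: subset_trans L32 L21.
by move=> Q acQ QL; apply/Q23/Q12.
Qed.

Lemma run_revise s r q (x y : 'I_n) (c : 'I_3) :
    reg s r = x -> reg s q = y -> G x y ->
  prunes s (run (revise r q c) s)
  /\ ((forall d, d != c -> (x, d) \notin lists s) ->
      (y, c) \notin lists (run (revise r q c) s)).
Proof.
move=> rx qy Gxy; set s' := run _ _.
set e := sum3 (fun d => if d == c then Const 0 else Get (3 + d) (Reg r)).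
have s'E : s' = if eval s e != 0 then s else set_arr s (3 + c) (reg s q) 0 by [].
have others : (eval s e != 0) = [exists d, (d != c) && ((x, d) \in lists s)].
  rewrite eval_sum3; apply: eq_existsb => d; rewrite in_cells -(inj_eq val_inj) /=.
  by case: ifP => //= _; rewrite rx.
have [e0|e0] := boolP (eval s e != 0).
  rewrite s'E e0; split; first exact: prunes_refl.
  move: e0; rewrite others => /existsP[d /andP[dc xd]] /(_ d dc).
  by rewrite xd.
have {}s'E z d : ((z, d) \in lists s') = ((z, d) != (y, c)) && ((z, d) \in lists s).
  rewrite s'E (negPf e0) !in_cells xpair_eqE -[z == y](inj_eq val_inj).
  rewrite -[d == c](inj_eq val_inj) /= /upd qy eqn_add2l.
  by case: (d =P c :> nat) => [->|_]; rewrite ?andbF //; case: (z =P y :> nat).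
split; last by rewrite s'E eqxx.
split=> [|Q acQ /subsetP QL]; apply/subsetP => -[z d]; rewrite s'E; first by case/andP.
move=> zd; rewrite QL // andbT; apply: contraNneq e0 => -[zy dc].
rewrite zy dc in zd; have [d' d'c xd'] := acQ _ _ _ Gxy zd.
by rewrite others; apply/existsP; exists d'; rewrite d'c QL.
Qed.

(** Lists only shrink during the sweep, so a removal that the initial lists force is still made at
    its turn. A sweep without change thus certifies arc consistency. *)
Lemma run_revise_all s : env s ->
  prunes s (run revise_all s)
  /\ (lists (run revise_all s) = lists s -> arc_consistent G (lists s)).
Proof.
move=> Es.
pose revised x y c s' := G x y -> (forall d, d != c -> (x, d) \notin lists s) ->
  (y, c) \notin lists s'.
have mono x y c s1 s2 : prunes s1 s2 -> revised x y c s1 -> revised x y c s2.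
  by case=> /subsetP L21 _ r1 Gxy xL; apply: contra (r1 Gxy xL) => /L21.
suff [pr rev] : prunes s (run revise_all s)
    /\ forall x y c, revised x y c (run revise_all s).
  split=> // sE x y c Gxy yc.
  have [/existsP[d /andP[dc xd]]|no] :=
    boolP [exists d, (d != c) && ((x, d) \in lists s)].
    by exists d.
  move: (rev x y c Gxy); rewrite sE yc => /(_ _)/negP[] // d dc.
  by apply: contra no => xd; apply/existsP; exists d; rewrite dc.
apply: (for_all (@prunes_trans) (P := fun x s' => forall y c, revised x y c s')) => //.
- by case: Es.
- by move=> x s1 s2 s12 r1 y c; apply: mono s12 (r1 y c).
move=> x s1 fr1 ps1 s1x; have E1 : env s1 by apply: env_same fr1 _ _ Es.
apply: (for_all (@prunes_trans) (P := fun y s' => forall c, revised x y c s')) => //.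
- by case: E1.
- by move=> y s2 s3 s23 r2 c; apply: mono s23 (r2 c).
move=> y s2 fr2 ps2 s2y; have E2 : env s2 by apply: env_same fr2 _ _ E1.
have s2x : reg s2 8 = x by case: fr2 => + _ => ->.
have edgexy := edgeE E2 s2x s2y.
rewrite -[run _ s2]/(if eval s2 (edge 8 9) != 0 then run (Each (revise 8 9)) s2 else s2).
rewrite edgexy; case Gxy : (G x y); last first.
  by split; [exact: prunes_refl | rewrite /revised Gxy].
apply: (each_all (@prunes_refl) (@prunes_trans)) => //.
- by move=> c s3 s4 s34; apply: mono.
move=> c s3 fr3 ps3.
have s3x : reg s3 8 = x by case: fr3 => + _ => ->.
have s3y : reg s3 9 = y by case: fr3 => + _ => ->.
have [p3 r3] := run_revise c s3x s3y Gxy; split=> // _ xL; apply: r3 => d dc.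
apply: contra (xL d dc).
by have [/subsetP L3 _] := prunes_trans ps1 (prunes_trans ps2 ps3); apply: L3.
Qed.

Lemma run_propagate s : env s ->
  propagation G (lists s) (lists (run propagate s)).
Proof.
(* A sweep either finds the lists stable or lowers [m] by one; at [m = 0] the lists are empty, hence
   arc consistent. *)
pose near m s' := arc_consistent G (lists s') \/ #|lists s'| <= m.
move=> Es.
have round m s' : env s' -> near m.+1 s' ->
    prunes s' (run revise_all s') /\ near m (run revise_all s').
  move=> Es' ns'; have [pr stable] := run_revise_all Es'; split=> //.
  have [L' Q'] := pr.
  case: ns' => [ac|le]; last first.
    have [same_lists|ne] := eqVneq (lists (run revise_all s')) (lists s').
      by left; rewrite same_lists; apply: stable.
    by right; rewrite -ltnS (leq_trans _ le) // proper_card // properEneq ne.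
  left; suff -> : lists (run revise_all s') = lists s' by [].
  by apply/eqP; rewrite eqEsubset L' Q'.
suff [[Ls Qs] nears] : prunes s (run propagate s) /\ near (3 * (n - n)) (run propagate s).
  split=> //; case: nears => //; rewrite subnn muln0 leqn0 cards_eq0 => /eqP ->.
  by move=> x y c _; rewrite inE.
apply: (for_ind (I := fun i s' => prunes s s' /\ near (3 * (n - i)) s')) => //.
- by case: Es.
- split; first exact: prunes_refl.
  by right; rewrite subn0 (leq_trans (max_card _)) // card_prod !card_ord mulnC.
move=> i s0 fr0 _ [pr0 near0]; have E0 : env s0 by apply: env_same fr0 _ _ Es.
have E1 : env (run revise_all s0) by apply: env_run.
have E2 : env (run revise_all (run revise_all s0)) by apply: env_run.
have near0' : near (3 * (n - i.+1)).+3 s0.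
  by move: near0; rewrite -[n - i]subnSK // mulnS.
have [pr1 near1] := round _ _ E0 near0'; have [pr2 near2] := round _ _ E1 near1.
have [pr3 near3] := round _ _ E2 near2; split=> //.
by apply: prunes_trans pr0 (prunes_trans pr1 (prunes_trans pr2 pr3)).
Qed.

Definition nonempty L : Prop := forall x, exists c, (x, c) \in L.

Definition disjoint_on_edges L : Prop :=
  forall x y c, G x y -> (x, c) \in L -> (y, c) \notin L.

(** The second clause retains a failure once found, the third excludes false alarms. *)
Definition checks (C : {set 'I_n * 'I_3} -> Prop) s s' : Prop :=
  [/\ lists s' = lists s, reg s' 6 != 0 -> reg s 6 != 0
    & C (lists s) -> reg s 6 != 0 -> reg s' 6 != 0].

Lemma checks_refl C s : checks C s s. Proof. by []. Qed.

Lemma checks_trans C s1 s2 s3 : checks C s1 s2 -> checks C s2 s3 -> checks C s1 s3.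
Proof.
move=> [L21 R21 C12] [L32 R32 C23]; split; first by rewrite L32.
  by move/R32/R21.
by move=> C1 /(C12 C1); apply: C23; rewrite L21.
Qed.

Lemma run_check_nonempty s : env s ->
  reg (run check_nonempty s) 6 != 0 <-> reg s 6 != 0 /\ nonempty (lists s).
Proof.
move=> Es.
suff [[_ down up] ne] : checks nonempty s (run check_nonempty s)
    /\ forall x, reg (run check_nonempty s) 6 != 0 -> exists c, (x, c) \in lists s.
  by split=> [r6|[r6 C]]; [split; [exact: down | move=> x; apply: ne] | exact: up].
apply: (for_all (@checks_trans nonempty)
  (P := fun x s' => reg s' 6 != 0 -> exists c, (x, c) \in lists s)) => //.
- by case: Es.
- by move=> x s1 s2 [_ down _] P1 /down.
move=> x s1 fr1 [L1 _ _] s1x.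
set e := sum3 (fun d => Get (3 + d) (Reg 8)).
rewrite -[run _ s1]/(if eval s1 e != 0 then s1 else set_reg s1 6 0).
have eE : (eval s1 e != 0) = [exists c, (x, c) \in lists s].
  by rewrite eval_sum3; apply: eq_existsb => c; rewrite -L1 in_cells /= s1x.
rewrite eE; case: (altP existsP) => [xc|no]; first by [].
split; last by rewrite /= /upd.
split=> // ne; have [c] := ne x; rewrite L1 => xc.
by case/negP: no; apply/existsP; exists c.
Qed.

Lemma run_check_disjoint s : env s ->
  reg (run check_disjoint s) 6 != 0
    <-> reg s 6 != 0 /\ disjoint_on_edges (lists s).
Proof.
move=> Es.
pose apart x y c s' := reg s' 6 != 0 ->
  G x y -> (x, c) \in lists s -> (y, c) \notin lists s.
have mono x y c s1 s2 :
    checks disjoint_on_edges s1 s2 -> apart x y c s1 -> apart x y c s2.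
  by case=> _ down _ a1 /down/a1.
suff [[_ down up] ap] : checks disjoint_on_edges s (run check_disjoint s)
    /\ forall x y c, apart x y c (run check_disjoint s).
  split=> [r6|[r6 C]]; last exact: up.
  by split; [exact: down | move=> x y c; apply: ap].
apply: (for_all (@checks_trans disjoint_on_edges)
  (P := fun x s' => forall y c, apart x y c s')) => //.
- by case: Es.
- by move=> x s1 s2 s12 a1 y c; apply: mono s12 (a1 y c).
move=> x s1 fr1 [L1 _ _] s1x; have E1 : env s1 by apply: env_same fr1 _ _ Es.
apply: (for_all (@checks_trans disjoint_on_edges)
  (P := fun y s' => forall c, apart x y c s')) => //.
- by case: E1.
- by move=> y s2 s3 s23 a2 c; apply: mono s23 (a2 c).
move=> y s2 fr2 [L2 _ _] s2y; have E2 : env s2 by apply: env_same fr2 _ _ E1.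
have s2x : reg s2 8 = x by case: fr2 => + _ => ->.
set body := Each _.
rewrite -[run _ s2]/(if eval s2 (edge 8 9) != 0 then run body s2 else s2).
rewrite (edgeE E2 s2x s2y); case Gxy : (G x y); last first.
  by split; [exact: checks_refl | rewrite /apart Gxy].
apply: (each_all (@checks_refl _) (@checks_trans disjoint_on_edges)) => //.
  by move=> c s3 s4 s34; apply: mono.
move=> c s3 fr3 [L3 _ _].
have s3x : reg s3 8 = x by case: fr3 => + _ => ->.
have s3y : reg s3 9 = y by case: fr3 => + _ => ->.
rewrite [run _ s3]/= s3x s3y -!in_cells /apart -L1 -L2 -L3.
case: ifP => xc; last by split; [exact: checks_refl |].
case: ifP => yc; last by split; [exact: checks_refl |].
by split; [split=> // dj; have := dj x y c Gxy xc; rewrite yc | rewrite /= /upd].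
Qed.

Lemma run_trial s (x : 'I_n) (c : 'I_3) : env s -> reg s 5 = x ->
  let L := [set p in lists s | (p.1 == x) ==> (p.2 == c)] in
  exists2 P, propagation G L P
    & nonempty P /\ lists (run (trial 5 c) s) = P
      \/ ~ nonempty P /\ lists (run (trial 5 c) s) = lists s.
Proof.
move=> Es s5 L.
set s1 := run (table 6 8 (fun d => Get (3 + d) (Reg 8))) s.
set s2 := run (assign 5 c) s1; set s3 := run propagate s2.
set s4 := run check_nonempty (set_reg s3 6 1).
have -> : run (trial 5 c) s = if reg s4 6 != 0 then s4
    else run (table 3 8 (fun d => Get (6 + d) (Reg 8))) s4 by [].
have E1 : env s1 by apply: env_run.
have E2 : env s2 by apply: env_run.
have E3 : env s3 by apply: env_run.
have E4 : env s4 by apply: env_run.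
(* Nothing between the backup and the restoration writes to arrays 6 to 8. *)
have backup : cells 6 s4 = lists s.
  have -> : cells 6 s4 = cells 6 s3 by rewrite /s4 cells_run.
  rewrite /s3 cells_run // /s2 cells_run //.
  apply: run_table => //; first by case: Es.
  move=> s' y d fr s'y; rewrite -(cells_same fr) // in_cells /=.
  by rewrite s'y.
have L2 : lists s2 = L.
  rewrite (run_assign _ (y := x)); last by rewrite run_reg.
  by rewrite cells_run.
have L4 : lists s4 = lists s3 by rewrite cells_run.
exists (lists s3); first by rewrite -L2; apply: run_propagate.
have [to from] : reg s4 6 != 0 <-> reg (set_reg s3 6 1) 6 != 0 /\ nonempty (lists s3).
  exact: run_check_nonempty.
case: ifP => r6; [left | right].
  by have [_ ne] := to r6; split; rewrite // cells_run.
split=> [ne|]; first by move: r6; rewrite from.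
rewrite -backup; apply: run_table => //; first by case: E4.
move=> s' y d fr s'y; rewrite -(cells_same fr) // in_cells /=.
by rewrite s'y.
Qed.

Lemma run_greedy s f : env s -> short (lists s) -> colors_from G (lists s) f ->
  exists2 g, proper_coloring G g
    & forall x c, ((x, c) \in lists (run greedy s)) = (c == g x).
Proof.
move=> Es short_s from_f.
pose R s s' := lists s' \subset lists s /\ (short (lists s) ->
  (exists f, colors_from G (lists s) f) -> exists f, colors_from G (lists s') f).
have R_refl s1 : R s1 s1 by [].
have R_trans s1 s2 s3 : R s1 s2 -> R s2 s3 -> R s1 s3.
  move=> [L21 C12] [L32 C23]; split; first exact: subset_trans L32 L21.
  by move=> sh /(C12 sh); apply: C23; apply: short_sub sh.
(* An accepted trial leaves [x] at most the color [c]. A rejected one shows that no coloring from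
   the lists gives [x] the color [c], and the claim is vacuous. With all three colors decided, any
   coloring from the lists is the only one left. *)
pose decided x c s' := forall g, colors_from G (lists s') g -> g x = c ->
  assigned (lists s') g x.
have mono x c s1 s2 : R s1 s2 -> decided x c s1 -> decided x c s2.
  move=> [L21 _] d1 g g2 gx d xd; apply: d1 (subsetP L21 _ xd) => //.
  exact: colors_from_sub g2.
suff [[_ Rs] dec] : R s (run greedy s) /\ forall x c, decided x c (run greedy s).
  have [|g g_from] := Rs short_s; first by exists f.
  exists g; first by case: g_from.
  move=> x c; apply/idP/eqP => [|->]; last by case: g_from.
  exact: (dec x (g x)).
apply: (for_all R_trans (P := fun x s' => forall c, decided x c s')) => //.
- by case: Es.
- by move=> x s1 s2 s12 d1 c; apply: mono s12 (d1 c).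
move=> x s1 fr1 _ s1x; have E1 : env s1 by apply: env_same fr1 _ _ Es.
apply: (each_all R_refl R_trans) => //.
  by move=> c s2 s3 s23; apply: mono.
move=> c s2 fr2 _; have E2 : env s2 by apply: env_same fr2 _ _ E1.
have s2x : reg s2 5 = x by case: fr2 => + _ => ->.
have [P propP []] := run_trial c E2 s2x; move=> [neP lP].
  case: propP => PL acP _; have PL2 : P \subset lists s2.
    by apply: subset_trans PL _; apply/subsetP => p; rewrite inE => /andP[].
  split.
    by split; rewrite lP // => sh [h hL]; apply: colors_from_short hL.
  move=> g gP gx d; rewrite lP => /(subsetP PL).
  by rewrite inE /= eqxx gx => /andP[_ /eqP].
split; first by rewrite /R lP.
move=> g; rewrite lP => g_from gx; case: neP => y; exists (g y).
have [|_ gP] := colors_from_propagation propP (f := g); last exact: gP.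
have [pg gL] := g_from; split=> // z; rewrite inE gL /=.
by apply/implyP => /eqP->; rewrite gx.
Qed.

(** * Output, soundness and completeness of the search *)

Definition writes_coloring s : Prop :=
  exists2 f : 'I_n -> 'I_3, proper_coloring G f & forall i : 'I_n, arr s 1 i = f i.

(** With nonempty lists that are disjoint along edges, any choice of colors is proper, so it does
    not matter which color of a list is written last. *)
Lemma run_output s : env s -> nonempty (lists s) -> disjoint_on_edges (lists s) ->
  reg (run output s) 1 = 1 /\ writes_coloring (run output s).
Proof.
move=> Es neL disL; rewrite -[run output s]/(run write_colors (set_reg s 1 1)).
split; first by rewrite run_reg.
set s' := run _ _.
pose written x s' := exists2 c : 'I_3, (x, c) \in lists s & arr s' 1 x = c.
pose R s s' := lists s' = lists s /\ forall x, written x s -> written x s'.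
have R_refl s1 : R s1 s1 by [].
have R_trans s1 s2 s3 : R s1 s2 -> R s2 s3 -> R s1 s3.
  by move=> [L21 w12] [L32 w23]; split; [rewrite L32 | move=> x /w12/w23].
have [_ wr] : R (set_reg s 1 1) s' /\ forall x, written x s'.
  apply: (for_all R_trans (P := written)) => //.
  - by case: Es.
  - by move=> x s1 s2 [_ w12] /w12.
  move=> x s1 fr1 [L1 _] s1x; set body := Each _.
  suff [R1 w1] : R s1 (run body s1)
      /\ forall c, (x, c) \in lists s -> written x (run body s1).
    by split=> //; have [c xc] := neL x; apply: w1 xc.
  apply: (each_all R_refl R_trans (P := fun c s' => (x, c) \in lists s -> written x s')).
    by move=> c s2 s3 [_ w23] w2 /w2/w23.
  move=> c s2 fr2 [L2 _]; have s2x : reg s2 8 = x by case: fr2 => + _ => ->.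
  rewrite [run _ s2]/= s2x -in_cells.
  have L2s : lists s2 = lists s by rewrite L2 L1.
  rewrite L2s; case: ifP => xc; last by [].
  have w : written x (set_arr s2 1 x c) by exists c; rewrite //= /upd !eqxx.
  split=> //; split=> // z [d zd s2z].
  have [->|zx] := eqVneq z x; first exact: w.
  by exists d; rewrite //= /upd; move: zx; rewrite -(inj_eq val_inj) /= => /negPf->.
exists (fun x => inord (arr s' 1 x)) => [x y Gxy|x].
  have [[c xc ->] [d yd ->]] := (wr x, wr y); rewrite !inord_val.
  by apply: contraTneq yd => <-; apply: disL xc.
by have [c _ ->] := wr x; rewrite inord_val.
Qed.

Lemma run_finish s : env s ->
    reg (run finish s) 1 = reg s 1 /\ arr (run finish s) 1 = arr s 1
      /\ ~ (nonempty (lists s) /\ disjoint_on_edges (lists s))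
  \/ reg (run finish s) 1 = 1 /\ writes_coloring (run finish s).
Proof.
move=> Es; set s1 := run check_nonempty (set_reg s 6 1).
set s2 := run check_disjoint s1.
have -> : run finish s = if reg s2 6 != 0 then run output s2 else s2 by [].
have E1 : env s1 by apply: env_run.
have E2 : env s2 by apply: env_run.
have L1 : lists s1 = lists s by rewrite /s1 cells_run.
have L2 : lists s2 = lists s by rewrite /s2 cells_run.
have [to1 from1] : reg s1 6 != 0 <-> reg (set_reg s 6 1) 6 != 0 /\ nonempty (lists s).
  exact: run_check_nonempty.
have [to2 from2] : reg s2 6 != 0 <-> reg s1 6 != 0 /\ disjoint_on_edges (lists s1).
  exact: run_check_disjoint.
rewrite L1 in to2 from2; case: ifP => r6; [right | left].
  by have [/to1[_ ne] dis] := to2 r6; apply: run_output; rewrite ?L2.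
rewrite /s2 run_reg // run_arr // /s1 run_reg // run_arr //.
split=> //; split=> // -[ne dis]; move: r6; rewrite from2 //.
by split=> //; apply: from1.
Qed.

Definition sound s : Prop :=
  reg s 1 = 0 \/ reg s 1 = 1 /\ writes_coloring s.

Definition good (v u w : 'I_n) (a b c : 'I_3) : Prop :=
  exists f, [/\ proper_coloring G f, f v = a, f u = b, f w = c
    & forall P, arc_consistent G P -> assigned P f v -> assigned P f u ->
        assigned P f w -> short P].

(** A later success may replace the coloring written, but a positive answer is never withdrawn. *)
Definition progress s s' : Prop :=
  (env s -> env s' /\ (sound s -> sound s')) /\ (reg s 1 = 1 -> reg s' 1 = 1).

Lemma progress_refl s : progress s s. Proof. by []. Qed.

Lemma progress_trans s1 s2 s3 : progress s1 s2 -> progress s2 s3 -> progress s1 s3.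
Proof.
move=> [e12 r12] [e23 r23]; split=> [/e12[/e23[E3 s23] s12]|/r12/r23] //.
by split=> // /s12/s23.
Qed.

(** Soundness comes from the final checks. For a good guess, [f] survives propagation, the lists
    become short, and [greedy] ends with the lists of a proper coloring, which pass the checks. *)
Lemma run_guess s (v u w : 'I_n) (a b c : 'I_3) : env s ->
    reg s 2 = v -> reg s 3 = u -> reg s 4 = w ->
  progress s (run (guess a b c) s)
  /\ (good v u w a b c -> reg (run (guess a b c) s) 1 = 1).
Proof.
move=> Es sv su sw.
set s1 := run (table 3 8 (fun=> Const 1)) s; set s2 := run (assign 2 a) s1.
set s3 := run (assign 3 b) s2; set s4 := run (assign 4 c) s3.
set s5 := run propagate s4; set s6 := run greedy s5.
have -> : run (guess a b c) s = run finish s6 by rewrite /guess 6!run_seq.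
have E1 : env s1 by apply: env_run.
have E2 : env s2 by apply: env_run.
have E3 : env s3 by apply: env_run.
have E4 : env s4 by apply: env_run.
have E5 : env s5 by apply: env_run.
have E6 : env s6 by apply: env_run.
have r1 : reg s6 1 = reg s 1 by rewrite /s6 run_reg // /s5 run_reg // /s4 !run_reg.
have a1 : arr s6 1 = arr s 1 by rewrite /s6 run_arr // /s5 run_arr // /s4 !run_arr.
have E7 : env (run finish s6) by apply: env_run.
move: (run finish s6) (run_finish E6) E7 => s7 fin E7.
split; first split.
- move=> _; split=> //; rewrite /sound.
  case: fin => [[-> [aE _]]|]; last by right.
  by rewrite r1 /writes_coloring aE a1.
- by move=> s1E; case: fin => [[-> _]|[]//]; rewrite r1.
move=> [f [pf fv fu fw sh]].
have L1 : lists s1 = setT.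
  by apply: run_table => //; [case: Es | move=> s' y d _ _; rewrite inE].
have L4 : lists s4 = [set p | [&& (p.1 == v) ==> (p.2 == a),
    (p.1 == u) ==> (p.2 == b) & (p.1 == w) ==> (p.2 == c)]].
  rewrite /s4 (run_assign _ (y := w)); last by rewrite !run_reg.
  rewrite /s3 (run_assign _ (y := u)); last by rewrite !run_reg.
  rewrite /s2 (run_assign _ (y := v)); last by rewrite !run_reg.
  by apply/setP => p; rewrite L1 !inE /= -andbA.
have prop5 : propagation G (lists s4) (lists s5) by apply: run_propagate.
have [/subsetP L54 ac5 _] := prop5.
have short5 : short (lists s5).
  apply: sh => // d /L54; rewrite L4 inE /= eqxx /=; case/and3P.
  - by move=> /eqP-> _ _.
  - by move=> _ /eqP-> _.
  - by move=> _ _ /eqP->.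
have from5 : colors_from G (lists s5) f.
  apply: colors_from_propagation prop5 _; split=> // x; rewrite L4 inE /=.
  by apply/and3P; split; apply/implyP => /eqP->; rewrite ?fv ?fu ?fw.
have [g pg gE] := run_greedy E5 short5 from5.
case: fin => [[_ [_ []]]|[]//]; split=> [x|x y d Gxy].
  by exists (g x); rewrite gE.
by rewrite !gE => /eqP->; apply: pg.
Qed.

Lemma run_search s : env s ->
  progress s (run search s)
  /\ forall v u w a b c, good v u w a b c -> reg (run search s) 1 = 1.
Proof.
move=> Es.
pose found v u w a b c s' := good v u w a b c -> reg s' 1 = 1.
have mono v u w a b c s1 s2 :
    progress s1 s2 -> found v u w a b c s1 -> found v u w a b c s2.
  by case=> _ keep f1 /f1/keep.
apply: (for_all (@progress_trans)
  (P := fun v s' => forall u w a b c, found v u w a b c s')) => //.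
- by case: Es.
- by move=> v s1 s2 s12 f1 u w a b c; apply: mono s12 (f1 u w a b c).
move=> v s1 fr1 _ s1v; have E1 : env s1 by apply: env_same fr1 _ _ Es.
apply: (for_all (@progress_trans)
  (P := fun u s' => forall w a b c, found v u w a b c s')) => //.
- by case: E1.
- by move=> u s2 s3 s23 f2 w a b c; apply: mono s23 (f2 w a b c).
move=> u s2 fr2 _ s2u; have E2 : env s2 by apply: env_same fr2 _ _ E1.
apply: (for_all (@progress_trans)
  (P := fun w s' => forall a b c, found v u w a b c s')) => //.
- by case: E2.
- by move=> w s3 s4 s34 f3 a b c; apply: mono s34 (f3 a b c).
move=> w s3 fr3 _ s3w; have E3 : env s3 by apply: env_same fr3 _ _ E2.
apply: (each_all (@progress_refl) (@progress_trans)
  (P := fun a s' => forall b c, found v u w a b c s')) => //.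
  by move=> a s4 s5 s45 f4 b c; apply: mono s45 (f4 b c).
move=> a s4 fr4 _.
apply: (each_all (@progress_refl) (@progress_trans)
  (P := fun b s' => forall c, found v u w a b c s')) => //.
  by move=> b s5 s6 s56 f5 c; apply: mono s56 (f5 c).
move=> b s5 fr5 _.
apply: (each_all (@progress_refl) (@progress_trans)) => //.
  by move=> c s6 s7; apply: mono.
move=> c s6 fr6 _.
have E4 : env s4 by apply: env_same fr4 _ _ E3.
have E5 : env s5 by apply: env_same fr5 _ _ E4.
have E6 : env s6 by apply: env_same fr6 _ _ E5.
apply: run_guess => //.
- by rewrite (proj1 fr6) // (proj1 fr5) // (proj1 fr4) // (proj1 fr3) // (proj1 fr2).
- by rewrite (proj1 fr6) // (proj1 fr5) // (proj1 fr4) // (proj1 fr3).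
- by rewrite (proj1 fr6) // (proj1 fr5) // (proj1 fr4).
Qed.

Lemma run_row_offsets : env (run row_offsets (init G)).
Proof.
have [offsets matrix] : (forall j, j <= n -> arr (run row_offsets (init G)) 2 j = j * n)
    /\ arr (run row_offsets (init G)) 0 = arr (init G) 0.
  split; last by rewrite run_arr.
  apply: (for_ind (I := fun i s => forall j, j <= i -> arr s 2 j = j * n)) => //.
    by move=> j; rewrite leqn0 => /eqP->.
  move=> i s [rE _] si offs j; rewrite leq_eqVlt ltnS => /orP[/eqP->|ji].
    by rewrite /= /upd /= si rE // addn1 eqxx offs // mulSn addnC.
  by rewrite /= /upd /= si addn1 ltn_eqF ?ltnS // offs.
split=> [|i j]; first by rewrite run_reg.
rewrite offsets; last exact: ltnW.
rewrite matrix /= /upd /= eqb0 negbK.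
apply/existsP/idP => [[i' /existsP[j' /andP[/eqP ij Gij]]]|Gij].
  have n0 : 0 < n by apply: leq_ltn_trans (ltn_ord i).
  (* Division with remainder by n recovers the row and the column from the position. *)
  have -> : i = i'.
    apply: val_inj; move: (congr1 (fun m => m %/ n) ij).
    by rewrite !divnMDl // !divn_small // !addn0.
  have -> // : j = j'.
  by apply: val_inj; move: (congr1 (fun m => m %% n) ij); rewrite !modnMDl !modn_small.
by exists i; apply/existsP; exists j; rewrite eqxx.
Qed.

End Algorithm.

Lemma run_solve n (G : sgraph 'I_n) :
    irreducible G -> has_diam G 2 -> (exists v, articulation_nbhd G v) ->
  let s := run solve (init G) in
  colorable G 3 /\ reg s 1 = 1 /\ writes_coloring G s
  \/ ~ colorable G 3 /\ reg s 1 = 0.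
Proof.
move=> irrG dG [v artG] s.
have E0 := run_row_offsets G.
have [[keep _] found] := run_search E0.
have snd : sound G s.
  have [_] := keep E0; apply; left.
  by rewrite run_reg.
case: snd => [s1|[s1 [f pf fE]]]; last first.
  by left; split; [exists f | split=> //; exists f].
right; split=> // -[f pf].
(* The vertices [u] and [w] depend on the unknown coloring [f], which is why the search runs over
   all triples and all their colors. *)
have [u [w sh]] := short_of_articulation irrG dG artG pf.
have : reg s 1 = 1 by apply: (found v u w (f v) (f u) (f w)); exists f.
by rewrite s1.
Qed.

Lemma wf_solve : wf solve.
Proof. by vm_compute. Qed.

Theorem theorem3 :
  let K (n : nat) (G : sgraph 'I_n) : Prop :=
    [/\ irreducible G, has_diam G 2 & exists v : 'I_n, articulation_nbhd G v] in
  poly_time_decidable_on K (fun (n : nat) (G : sgraph 'I_n) => colorable G 3)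
  /\ poly_time_coloring_on K 3.
Proof.
split.
  apply: (poly_time_on_loop (r := 1) wf_solve) => n G [irrG dG artG].
  by case: (run_solve irrG dG artG) => [[col [r1 _]]|[col r0]]; split.
apply: (poly_time_on_loop (r := 1) wf_solve) => n G [[irrG dG artG] col].
case: (run_solve irrG dG artG) => [[_ [_ [f pf fE]]]|[]//].
by exists f; split=> // i; rewrite -fE.
Qed.
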